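(* Let $N$ be a positive integer, $S>0$, and let $u\mapsto \mathbf{s}(u)\in\mathbb{R}^N$, $u\in[0,1)$, be a measurable map with $\|\mathbf{s}(u)\|=S$ for all $u$. Let $\theta\in(0,\frac{\pi}{2})$. Then there exists a unit vector $\mathbf{g}\in\mathbb{R}^N$ such that the Lebesgue measure of the set $\{u\in[0,1):\ \langle \mathbf{s}(u),\mathbf{g}\rangle\ge S\cos\theta\}$ is at least \[ \exp\left\{ \frac{N}{2}\cdot\left[\log\left(\sin^{2}\theta\right)-\Theta\left(\frac{\log N}{N}\right)\right]\right\}, \] where the $\Theta(\frac{\log N}{N})$ term depends only on $N$ and $\theta$ (not on the map $\mathbf{s}$).
   Context: In the paper, $S=\sqrt{PT}$, $N=2WT$, and $\mathbf{s}(u)$ is the coefficient vector of the transmitted signal of a band-limited modulation system, normalized so that the power constraint holds with equality. $\langle\cdot,\cdot\rangle$ is the standard inner product; logarithms are natural. *)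

(* Defs.v *)
From HB Require Import structures.
From mathcomp Require Import all_boot all_order all_algebra.
From mathcomp Require Import all_classical all_reals all_analysis.
Set Implicit Arguments. Unset Strict Implicit. Unset Printing Implicit Defensive.
Import Order.TTheory GRing.Theory Num.Theory.
Local Open Scope ring_scope.

Definition dotv {R : realType} {N : nat} (x y : 'I_N -> R) : R :=
  \sum_(i < N) x i * y i.

Definition normv {R : realType} {N : nat} (x : 'I_N -> R) : R :=
  Num.sqrt (dotv x x).

(* Main.v *)
Require Import Defs.
From HB Require Import structures.
From mathcomp Require Import all_boot all_order all_algebra.
From mathcomp Require Import all_classical all_reals all_analysis.
From mathcomp Require Import measurable_realfun finmap ring lra zify.
Import Order.TTheory GRing.Theory Num.Theory.
Local Open Scope classical_set_scope.
Local Open Scope ring_scope.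

(** Let [g] range over the integer points of a large ball of radius [rho].  It
    suffices that, for every unit vector [x], at least a fraction
    [sin theta ^ N / O(N)] of these points makes an angle at most [theta] with
    [x]: averaging over [g] the measure of the set of [u] for which
    [s(u)] and [g] make an angle at most [theta] then produces a good [g].

    Neither rotation invariance nor an explicit volume is needed for the
    fraction.  Up to small corrections, points [h] of the ball of radius
    [rho sin theta] are sorted into [O(N)] slabs according to [<x, h>], and
    each slab is moved by a (rounded) multiple of [x] into the slab
    [<x, g> ~ rho cos theta] of the ball of that radius around
    [rho cos theta x]; this slab lies in the cone of angle [theta] around [x]
    and in the ball of radius [rho (1 + O(1/N))].  Comparing the numbers of
    integer points in balls of different radii, by coordinatewise division with
    remainder, gives the factor [sin theta ^ N]. *)

(** * Euclidean inner product and norm *)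

Section EuclideanNorm.
Context {R : realType} {N : nat}.
Implicit Types (x y z : 'I_N -> R) (a : R).

Lemma dotvC x y : dotv x y = dotv y x.
Proof. by apply: eq_bigr => i _; rewrite mulrC. Qed.

Lemma dotvDl x y z : dotv (fun i => x i + y i) z = dotv x z + dotv y z.
Proof. by rewrite /dotv -big_split; apply: eq_bigr => i _; rewrite mulrDl. Qed.

Lemma dotvZl a x z : dotv (fun i => a * x i) z = a * dotv x z.
Proof. by rewrite /dotv mulr_sumr; apply: eq_bigr => i _; rewrite mulrA. Qed.

Lemma dotvDr x y z : dotv z (fun i => x i + y i) = dotv z x + dotv z y.
Proof. by rewrite dotvC dotvDl !(dotvC z). Qed.

Lemma dotvZr a x z : dotv z (fun i => a * x i) = a * dotv z x.
Proof. by rewrite dotvC dotvZl dotvC. Qed.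

Lemma dotvv_ge0 x : 0 <= dotv x x.
Proof. by apply: sumr_ge0 => i _; rewrite -expr2 sqr_ge0. Qed.

Lemma normv_ge0 x : 0 <= normv x.
Proof. exact: sqrtr_ge0. Qed.

Lemma sqr_normv x : normv x ^+ 2 = dotv x x.
Proof. by rewrite sqr_sqrtr // dotvv_ge0. Qed.

Lemma normv_le x a : 0 <= a -> (normv x <= a) = (dotv x x <= a ^+ 2).
Proof.
by move=> a0; rewrite -sqr_normv ler_pXn2r // nnegrE ?normv_ge0.
Qed.

Lemma normvZ a x : normv (fun i => a * x i) = `|a| * normv x.
Proof.
by rewrite /normv dotvZl dotvZr mulrA -expr2 sqrtrM ?sqr_ge0 // sqrtr_sqr.
Qed.

Lemma ler_coord_normv x i : `|x i| <= normv x.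
Proof.
rewrite -(ler_pXn2r (n := 2)) ?nnegrE ?normv_ge0 // sqr_normv /dotv.
rewrite (bigD1 i) //= real_normK ?num_real // expr2 lerDl.
by apply: sumr_ge0 => j _; rewrite -expr2 sqr_ge0.
Qed.

(** The crude factor [N], instead of its square root, is good enough for all rounding errors
    below. *)
Lemma normv_le_sup x a : (forall i, `|x i| <= a) -> normv x <= N%:R * a.
Proof.
case: (posnP N) => [N0 _|N0 xa].
  rewrite normv_le; last by rewrite N0 mul0r.
  by rewrite /dotv big1 ?sqr_ge0 // => i _; have := ltn_ord i; rewrite {2}N0.
have a0 : 0 <= a by apply: le_trans (xa (Ordinal N0)).
rewrite normv_le ?mulr_ge0 //.
apply: (@le_trans _ _ (\sum_(i < N) a ^+ 2)).
  apply: ler_sum => i _; rewrite -expr2 -real_normK ?num_real //.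
  by rewrite ler_pXn2r ?nnegrE.
rewrite sumr_const card_ord -[leLHS]mulr_natl exprMn ler_wpM2r ?sqr_ge0 //.
by rewrite -natrX ler_nat; nia.
Qed.

(** Cauchy-Schwarz: with [A = <x,x>], [B = <y,y>], [C = <x,y>], the vector [B x - C y] has squared
    norm [B (A B - C^2)]; the case [B = 0] is separate. *)
Lemma dotv_le_normv x y : `|dotv x y| <= normv x * normv y.
Proof.
have xy0 : 0 <= normv x * normv y by rewrite mulr_ge0 ?normv_ge0.
rewrite -(ler_pXn2r (n := 2)) ?nnegrE // exprMn !sqr_normv.
rewrite real_normK ?num_real //.
have [y0|y0] := ltP 0 (dotv y y); last first.
  have ye0 : forall i, y i = 0.
    move=> i; apply/eqP; rewrite -normr_le0.
    apply: le_trans (ler_coord_normv y i) _.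
    by rewrite normv_le // expr0n.
  have -> : dotv x y = 0 by apply: big1 => i _; rewrite ye0 mulr0.
  by rewrite expr0n mulr_ge0 ?dotvv_ge0.
have := dotvv_ge0 (fun i => dotv y y * x i + - dotv x y * y i).
rewrite dotvDl !dotvDr !dotvZl !dotvZr (dotvC y x).
set A := dotv x x; set B := dotv y y; set C := dotv x y.
have -> : B * (B * A) + B * (- C * C) + (- C * (B * C) + - C * (- C * B))
  = B * (A * B - C ^+ 2) by ring.
by rewrite pmulr_rge0 // subr_ge0.
Qed.

Lemma normvD_le x y : normv (fun i => x i + y i) <= normv x + normv y.
Proof.
rewrite normv_le ?addr_ge0 ?normv_ge0 // dotvDl !dotvDr (dotvC y x).
have := dotv_le_normv x y; have := ler_norm (dotv x y).
have := sqr_normv x; have := sqr_normv y; nra.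
Qed.

End EuclideanNorm.

(** * Counting by injections into and out of products *)

Section FsetCounting.
Context {K K' : choiceType} {T : finType}.
Variables (A : {fset K}) (B : {fset K'}).

Lemma leq_card_fset_prod (c : K -> T) (f : K -> K') :
  {in A, forall x, f x \in B} ->
  {in A &, forall x y, c x = c y -> f x = f y -> x = y} ->
  (#|` A| <= #|T| * #|` B|)%N.
Proof.
move=> fB cfI.
pose F (a : A) : T * B := (c (val a), [` fB _ (valP a)]%fset).
have /leq_card : injective F.
  move=> a b [cab fab]; apply: val_inj; apply: cfI cab fab; exact: valP.
by rewrite card_prod -!cardfE.
Qed.

Lemma leq_card_prod_fset (f : T -> K -> K') :
  {in A, forall x t, f t x \in B} ->
  {in A &, forall x y t u, f t x = f u y -> t = u /\ x = y} ->
  (#|T| * #|` A| <= #|` B|)%N.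
Proof.
move=> fB fI.
pose F (p : T * A) : B := [` fB _ (valP p.2) p.1]%fset.
have /leq_card : injective F.
  move=> [t a] [u b] /(congr1 val) /= /fI [] //; try exact: valP.
  by move=> -> /val_inj ->.
by rewrite card_prod -!cardfE.
Qed.

End FsetCounting.

(** * Integer points in balls of different radii *)

Section LatticeBall.
Context {R : realType} {N : nat}.
Local Notation lattice := {ffun 'I_N -> int}.

Definition vec_of_lattice (z : lattice) : 'I_N -> R := fun i => (z i)%:~R.

(** Enumerates the cube [[-r, r]^N], so that the ball inside it is a finite set. *)
Definition box_point (r : nat) (f : {ffun 'I_N -> 'I_(2 * r).+1}) : lattice :=
  [ffun i => (f i : nat)%:Z - r%:Z].

Definition lattice_box (r : nat) : {fset lattice} :=
  [fset box_point r f | f in {: {ffun 'I_N -> 'I_(2 * r).+1}}]%fset.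

Definition lattice_ball (r : nat) : {fset lattice} :=
  [fset z in lattice_box r | normv (vec_of_lattice z) <= r%:R]%fset.

Lemma in_lattice_ball r z :
  (z \in lattice_ball r) = (normv (vec_of_lattice z) <= r%:R).
Proof.
rewrite !inE /=; apply/andb_idl => zr.
have zbnd i : (`|z i| <= r%:Z)%R.
  have := le_trans (ler_coord_normv _ i) zr.
  by rewrite /vec_of_lattice -intr_norm -[r%:R]/((r%:Z)%:~R) ler_int.
apply/imfsetP => /=; exists [ffun i => inord (absz (z i + r%:Z))] => //.
apply/ffunP => i; rewrite /box_point !ffunE.
have : (`|(z i : int)| <= r%:Z)%R := zbnd i.
by move: (z i : int) => a ar; rewrite inordK; lia.
Qed.

(** By uniqueness of division with remainder, the points [p y + e] with [0 <= e i < p] are distinct;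
    the digits [e] add at most [p N] to the norm. *)
Lemma card_lattice_ball_expand p r : (0 < p)%N ->
  (p ^ N * #|` lattice_ball r| <= #|` lattice_ball (p * (r + N))|)%N.
Proof.
move=> p0; have -> : (p ^ N = #|{ffun 'I_N -> 'I_p}|)%N.
  by rewrite card_ffun !card_ord.
pose f (e : {ffun 'I_N -> 'I_p}) (y : lattice) : lattice :=
  [ffun i => p%:Z * y i + (e i : nat)%:Z].
apply: (@leq_card_prod_fset _ _ _ _ _ f) => [y|y y' _ _ e e' eq_f].
  move=> + e; rewrite !in_lattice_ball => yr.
  have -> : vec_of_lattice (f e y) =
      (fun i => p%:R * vec_of_lattice y i + (e i : nat)%:R).
    by apply/funext => i; rewrite /vec_of_lattice ffunE intrD intrM.
  apply: le_trans (normvD_le _ _) _.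
  rewrite normvZ ger0_norm // natrM natrD mulrDr lerD ?ler_wpM2l //.
  rewrite mulrC; apply: normv_le_sup => i.
  by rewrite ger0_norm // ler_nat ltnW.
have ediv i : y i = y' i /\ e i = e' i :> nat.
  have := congr1 (fun g : lattice => g i) eq_f; rewrite !ffunE.
  move: (ltn_ord (e i)) (ltn_ord (e' i)).
  move: (y i : int) (y' i : int) (e i : nat) (e' i : nat) => a b k l kp lp.
  by case: (ltgtP a b) => ab ablk; [nia|nia|split; lia].
split; apply/ffunP => i; last by case: (ediv i).
by apply: val_inj; case: (ediv i).
Qed.

(** A point is determined by its quotient and remainder modulo [q]. There are [q ^ N] remainders,
    each of norm at most [q N], which enlarges the radius of the quotients by [N]. *)
Lemma card_lattice_ball_shrink q r : (0 < q)%N ->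
  (#|` lattice_ball (q * r)| <= q ^ N * #|` lattice_ball (r + N)|)%N.
Proof.
move=> q0; have -> : (q ^ N = #|{ffun 'I_N -> 'I_q}|)%N.
  by rewrite card_ffun !card_ord.
have modq (a : int) : (absz (a %% q)%Z < q)%N.
  have := @ltz_pmod a q; have := @modz_ge0 a q; lia.
pose f (z : lattice) : lattice := [ffun i => (z i %/ q)%Z].
pose c (z : lattice) : {ffun 'I_N -> 'I_q} := [ffun i => Ordinal (modq (z i))].
apply: (@leq_card_fset_prod _ _ _ _ _ c f) => [z|z z' _ _ eq_c eq_f].
  rewrite !in_lattice_ball natrM natrD => zr.
  rewrite -(ler_pM2l (x := q%:R)) ?ltr0n // mulrDr.
  have -> : q%:R * normv (vec_of_lattice (f z)) =
      normv (fun i => vec_of_lattice z i + - ((z i %% q)%Z)%:~R).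
    rewrite -[q%:R in LHS]ger0_norm // -normvZ; congr normv.
    apply/funext => i; rewrite /vec_of_lattice ffunE.
    by rewrite {2}(divz_eq (z i) q) intrD intrM addrK mulrC.
  apply: le_trans (normvD_le _ _) _; apply: lerD => //.
  rewrite mulrC; apply: normv_le_sup => i.
  by rewrite normrN -intr_norm -[q%:R]/((q%:Z)%:~R) ler_int; have := modq (z i); lia.
apply/ffunP => i.
have := congr1 (fun g : lattice => g i) eq_f; rewrite !ffunE => eqd.
have := congr1 (fun g : {ffun 'I_N -> 'I_q} => val (g i)) eq_c; rewrite !ffunE /= => eqm.
rewrite (divz_eq (z i) q) (divz_eq (z' i) q) eqd; congr (_ + _).
have := @modz_ge0 (z i) q; have := @modz_ge0 (z' i) q; lia.
Qed.

(** Discrete substitute for the scaling of volume by the [N]-th power of the radius. *)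
Lemma card_lattice_ball_ratio p q r : (0 < p)%N -> (0 < q)%N ->
  (p ^ N * #|` lattice_ball (q * r)| <=
   q ^ N * #|` lattice_ball (p * (r + N.*2))|)%N.
Proof.
move=> p0 q0; apply: leq_trans (leq_mul (leqnn _) (card_lattice_ball_shrink q r q0)) _.
rewrite mulnCA leq_mul2l -addnn addnA.
by rewrite card_lattice_ball_expand ?orbT.
Qed.

End LatticeBall.

(** * From a ball to a cone, slab by slab *)

Section Cone.
Context {R : realType} {N : nat}.
Variables (x : 'I_N -> R) (c s : R).
Hypotheses (x1 : normv x = 1) (c0 : 0 < c) (cs1 : c ^+ 2 + s ^+ 2 = 1).

Let dotxx : dotv x x = 1.
Proof. by rewrite -sqr_normv x1 expr1n. Qed.

(** At height [a = c * rho'] along [x], the ball of radius [s * rho'] around [a x] and the cone have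
    the same cross-section; above it the former narrows and the latter widens. Algebraically,
    [y^2 - c^2 |g|^2] is at least a product of two factors that are nonnegative for [y >= a]. *)
Lemma slab_subset_cone (g : 'I_N -> R) (rho rho' delta : R) :
  0 <= rho' -> 0 <= rho -> 0 <= delta ->
  c * rho' <= dotv x g <= c * rho' + delta ->
  normv (fun i => g i + - (c * rho') * x i) <= s * rho' ->
  rho' ^+ 2 + 2 * (c * rho') * delta <= rho ^+ 2 ->
  c * normv g <= dotv x g /\ normv g <= rho.
Proof.
move=> rho'0 rho0 delta0.
set a := c * rho'; set y := dotv x g => /andP[ay ya] gb rho_ge.
have a0 : 0 <= a by rewrite mulr_ge0 // ltW.
have b0 : 0 <= s * rho' by apply: le_trans (normv_ge0 _) gb.
have gg : dotv g g <= rho' ^+ 2 - 2 * a ^+ 2 + 2 * a * y.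
  move: gb; rewrite normv_le // dotvDl !dotvDr !dotvZl !dotvZr dotxx.
  rewrite (dotvC g x) -/y -/a => gb.
  have -> : rho' ^+ 2 = a ^+ 2 + (s * rho') ^+ 2.
    by rewrite /a !exprMn -mulrDl cs1 mul1r.
  by lra.
have ay_le : a * y <= a * (a + delta) by rewrite ler_wpM2l.
split; first last.
  by rewrite normv_le //; apply: le_trans gg (le_trans _ rho_ge); lra.
have y0 : 0 <= y by apply: le_trans ay.
rewrite -(ler_pXn2r (n := 2)) ?nnegrE ?mulr_ge0 ?normv_ge0 ?(ltW c0) //.
rewrite exprMn sqr_normv.
have c1 : c ^+ 2 <= 1 by rewrite -cs1 lerDl sqr_ge0.
apply: le_trans (ler_wpM2l (sqr_ge0 c) gg) _; rewrite -subr_ge0.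
have -> : y ^+ 2 - c ^+ 2 * (rho' ^+ 2 - 2 * a ^+ 2 + 2 * a * y) =
  (y - a) * (y - a + 2 * (a * (1 - c ^+ 2))) by rewrite /a; ring.
have ay0 : 0 <= y - a by rewrite subr_ge0.
apply: mulr_ge0 => //; apply: addr_ge0 => //.
by do 2 apply: mulr_ge0 => //; rewrite subr_ge0.
Qed.

(** As [c > 0], the strict inequality excludes only the origin, which has no direction. *)
Definition lattice_cone (rho : nat) : {fset {ffun 'I_N -> int}} :=
  [fset g in lattice_ball (R := R) rho | (0 < dotv x (vec_of_lattice g)) &&
     (c * normv (vec_of_lattice (R := R) g) <= dotv x (vec_of_lattice g))]%fset.

Lemma in_lattice_cone rho g : (g \in lattice_cone rho) =
  [&& g \in lattice_ball (R := R) rho, 0 < dotv x (vec_of_lattice g) &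
   c * normv (vec_of_lattice (R := R) g) <= dotv x (vec_of_lattice g)].
Proof. by rewrite in_fset inE /=. Qed.

(** Slabs have width [rho / m], so [2 m + 1] of them cover the ball of radius [b]. In the last
    hypothesis, [2 * (rho / m)] pays for the offset inside a slab and for rounding; the factor
    [1 - 4 / m] keeps the translated points within radius [rho]. *)
Lemma card_lattice_ball_le_cone (m b rho : nat) :
  (4 < m)%N -> (0 < rho)%N -> (2 * N * m <= rho)%N -> (b <= rho)%N ->
  b%:R + 2 * (rho%:R / m%:R) <= s * (rho%:R * (1 - 4 / m%:R)) ->
  (#|` lattice_ball (R := R) (N := N) b| <= (2 * m).+1 * #|` lattice_cone rho|)%N.
Proof.
move=> m4 rho0 rho_ge b_le hb.
have m0 : 0 < m%:R :> R by rewrite ltr0n; lia.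
have r0 : 0 < rho%:R :> R by rewrite ltr0n.
set d0 : R := rho%:R / m%:R in hb; have d0_gt0 : 0 < d0 by rewrite divr_gt0.
have Nd0 : 2 * N%:R <= d0.
  by rewrite ler_pdivlMr // -!natrM ler_nat.
have d0m : d0 * m%:R = rho%:R by rewrite divfK // gt_eqF.
set rho' : R := rho%:R * (1 - 4 / m%:R) in hb.
have rho'E : rho' = rho%:R - 4 * d0 by rewrite /rho' /d0; ring.
have rho'0 : 0 < rho'.
  rewrite /rho' mulr_gt0 // subr_gt0 ltr_pdivrMr // mul1r.
  by rewrite (ltr_nat _ 4).
set a := c * rho'; have a0 : 0 < a by rewrite mulr_gt0.
have c1 : c <= 1.
  rewrite -(ler_pXn2r (n := 2)) ?nnegrE ?(ltW c0) // expr1n -cs1 lerDl.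
  exact: sqr_ge0.
have arho : a <= rho%:R.
  by apply: le_trans (ler_piMl (ltW rho'0) c1) _; rewrite rho'E; lra.
pose t (h : {ffun 'I_N -> int}) : R := dotv x (vec_of_lattice h).
(* The shift by [m] makes the slab index nonnegative; on the ball it is at most [2 m], so [inord]
   never falls back to its default. *)
pose j (h : {ffun 'I_N -> int}) : 'I_(2 * m).+1 := inord (Num.truncn (t h / d0 + m%:R)).
(* Lifts the bottom of slab [k] to height [a + N]; the margin [N] keeps the point above [a] after
   rounding. *)
pose tau (k : 'I_(2 * m).+1) : R := a - (k%:R - m%:R) * d0 + N%:R.
pose f (h : {ffun 'I_N -> int}) : {ffun 'I_N -> int} :=
  [ffun i => h i + Num.floor (tau (j h) * x i)].
rewrite -[X in (_ <= X * _)%N]card_ord.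
apply: (@leq_card_fset_prod _ _ _ _ _ j f) => [h|h h' _ _ jh /ffunP fh].
  (* Within one slab the rounded translation is the same for all points, hence injective. *)
  2: by apply/ffunP => i; have := fh i; rewrite !ffunE jh => /addIr.
rewrite in_lattice_ball => hb'.
have th : `|t h| <= normv (vec_of_lattice (R := R) h).
  by have := dotv_le_normv x (vec_of_lattice h); rewrite x1 mul1r.
have hrho : `|t h| <= d0 * m%:R.
  by rewrite d0m; apply: le_trans th (le_trans hb' _); rewrite ler_nat.
have /andP[tl tu] : - m%:R <= t h / d0 <= m%:R.
  by rewrite ler_pdivrMr // ler_pdivlMr // mulNr ![m%:R * _]mulrC -ler_norml.
have /andP[jl ju] : (j h)%:R <= t h / d0 + m%:R < (j h)%:R + 1.
  have tm0 : 0 <= t h / d0 + m%:R by lra.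
  have /andP[tr_le tr_lt] := truncn_itv tm0.
  rewrite /j inordK; first by rewrite tr_le natr1.
  rewrite ltnS -(ler_nat R); apply: le_trans tr_le _.
  by rewrite natrM; lra.
(* The offset of [h] inside its slab. *)
pose fr := t h - ((j h)%:R - m%:R) * d0.
have /andP[frl fru] : 0 <= fr <= d0.
  have -> : fr = (t h / d0 + m%:R - (j h)%:R) * d0.
    by rewrite /fr !mulrBl mulrDl divfK ?gt_eqF //; ring.
  apply/andP; split; first by rewrite pmulr_lge0 //; lra.
  by apply: ler_piMl; [exact: ltW|lra].
pose e i := tau (j h) * x i - (Num.floor (tau (j h) * x i))%:~R.
have eN : normv e <= N%:R.
  rewrite -[N%:R]mulr1; apply: normv_le_sup => i.
  have /andP[fl fu] := floor_itv (tau (j h) * x i).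
  by rewrite /e; move: fu; rewrite intrD ler_norml; lra.
have xe : `|dotv x e| <= N%:R.
  by apply: le_trans (dotv_le_normv x e) _; rewrite x1 mul1r.
have fE : vec_of_lattice (f h) =
    (fun i => (vec_of_lattice h i + tau (j h) * x i) + - 1 * e i).
  apply/funext => i; rewrite /vec_of_lattice /e ffunE intrD.
  by rewrite mulN1r opprB addrACA subrr addr0.
clearbody e.
have yE : dotv x (vec_of_lattice (f h)) = a + fr + N%:R - dotv x e.
  by rewrite fE !dotvDr !dotvZr dotxx /tau /fr -/(t h); ring.
have htx : normv (fun i => vec_of_lattice h i + - t h * x i) <=
    normv (vec_of_lattice (R := R) h).
  rewrite normv_le ?normv_ge0 // sqr_normv dotvDl !dotvDr !dotvZl !dotvZr dotxx.
  by rewrite (dotvC _ x) -/(t h); have := sqr_ge0 (t h); lra.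
(* Split into the part of [h] orthogonal to [x], of norm at most [b], the multiple [fr + N] of [x],
   and the rounding error: in total at most [b + d0 + 2 N <= b + 2 d0]. *)
have gax : normv (fun i => vec_of_lattice (f h) i + - a * x i) <= s * rho'.
  have -> : (fun i => vec_of_lattice (f h) i + - a * x i) =
    (fun i => (vec_of_lattice h i + - t h * x i) +
       ((fr + N%:R) * x i + - 1 * e i)).
    by apply/funext => i; rewrite fE /fr /tau; ring.
  apply: le_trans (normvD_le _ _) _.
  apply: le_trans (lerD (le_trans htx hb') (normvD_le _ _)) _.
  have frN0 : 0 <= fr + N%:R by apply: addr_ge0.
  rewrite !normvZ x1 normrN normr1 mulr1 mul1r ger0_norm //.
  by apply: le_trans hb; lra.
move: xe; rewrite ler_norml => /andP[xel xeu].
have ya : a <= dotv x (vec_of_lattice (f h)) <= a + 2 * d0.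
  by rewrite yE; apply/andP; split; lra.
have d00 : 0 <= 2 * d0 by lra.
have rho_bnd : rho' ^+ 2 + 2 * a * (2 * d0) <= rho%:R ^+ 2.
  have := mulr_ge0 (ltW d0_gt0) (ltW rho'0); rewrite rho'E.
  have : a * d0 <= rho%:R * d0 by rewrite ler_wpM2r // ltW.
  by lra.
have [fcone fball] := slab_subset_cone _ _ _ _ (ltW rho'0) (ltW r0) d00 ya gax rho_bnd.
rewrite in_lattice_cone in_lattice_ball fball fcone /=.
by rewrite andbT; apply: lt_le_trans a0 _; case/andP: ya.
Qed.

End Cone.

(** * The fraction of integer points lying in a cone *)

Lemma bernoulli_onem_le {R : realType} (y : R) n :
  0 <= y <= 1 -> 1 - n%:R * y <= (1 - y) ^+ n.
Proof.
move=> /andP[y0 y1]; elim: n => [|n IH]; first by rewrite mul0r subr0 expr0.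
have y1' : 0 <= 1 - y by rewrite subr_ge0.
rewrite exprS; apply: le_trans (ler_wpM2l y1' IH).
rewrite -natr1; have := mulr_ge0 (ler0n R n) (sqr_ge0 y); lra.
Qed.

(** With [m = m0 * N] and [p] close to [m s], passing from radius [rho] to the smaller ball costs
    [(p / m) ^ N >= s ^ N / 2], and the slabs cost [2 m + 1 <= 3 m]; together this gives [6 m]. *)
Lemma card_lattice_cone_ge {R : realType} {N : nat} (x : 'I_N -> R) (c s : R)
    (m0 : nat) : normv x = 1 -> 0 < c -> 0 < s -> c ^+ 2 + s ^+ 2 = 1 ->
  (0 < N)%N -> 16 <= m0%:R * s ->
  s ^+ N / (6 * m0 * N)%:R * #|` lattice_ball (R := R) (N := N) (2 * N * (m0 * N) ^ 2)|%:R
  <= #|` lattice_cone x c (2 * N * (m0 * N) ^ 2)|%:R.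
Proof.
move=> x1 c0 s0 cs1 N0 m0s; move mE : (m0 * N)%N => m.
have s1 : s <= 1.
  rewrite -(ler_pXn2r (n := 2)) ?nnegrE ?(ltW s0) // expr1n -cs1 lerDr.
  exact: sqr_ge0.
have N1 : 1 <= N%:R :> R by rewrite ler1n.
have ms : 16 * N%:R <= m%:R * s.
  by rewrite -mE natrM mulrAC ler_wpM2r.
have m16 : 16 <= m%:R :> R.
  have : m%:R * s <= m%:R by rewrite ler_piMr.
  by lra.
have mp : 0 < m%:R :> R by lra.
have m_gt0 : (0 < m)%N by rewrite -(ltr_nat R).
set rho := (2 * N * m ^ 2)%N.
(* The 7 bounds [5 s + 2]: [4 s] from the factor [1 - 4 / m], [s] from [r + 2 N = 2 N (m + 1)], and
   2 from the slab and rounding allowance. Truncation then gives [p > m s - 8]. *)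
have ms7 : 0 <= m%:R * s - 7 by lra.
have /andP[] := truncn_itv ms7; set p := Num.truncn _ => pl.
rewrite -natr1 => pu.
have p0 : (0 < p)%N by rewrite -(ltr_nat R); lra.
pose r := (2 * N * m)%N.
have rhoE : rho = (m * r)%N by rewrite /rho /r; lia.
have bE : (p * (r + N.*2))%:R = 2 * N%:R * (p%:R * (m%:R + 1)) :> R.
  rewrite natrM natrD /r !natrM -mul2n natrM; ring.
have pm1 : p%:R * (m%:R + 1) <= (m%:R * s - 7) * (m%:R + 1) :> R.
  by rewrite ler_wpM2r //; lra.
have msm : m%:R * s <= m%:R by rewrite ler_piMr // ltW.
have rhoR : rho%:R = 2 * N%:R * m%:R ^+ 2 :> R by rewrite /rho natrM natrX natrM.
have hb : (p * (r + N.*2))%:R + 2 * (rho%:R / m%:R)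
    <= s * (rho%:R * (1 - 4 / m%:R)) :> R.
  have -> : s * (rho%:R * (1 - 4 / m%:R)) = 2 * N%:R * (s * (m%:R ^+ 2 - 4 * m%:R)).
    by rewrite rhoR; field; rewrite gt_eqF.
  have -> : rho%:R / m%:R = 2 * N%:R * m%:R :> R.
    by rewrite rhoR; field; rewrite gt_eqF.
  rewrite bE [2 * (2 * _ * _)]mulrCA -mulrDr ler_pM2l; last by lra.
  by lra.
have b_le : (p * (r + N.*2) <= rho)%N.
  rewrite -(ler_nat R); apply: le_trans (_ : s * rho%:R <= _).
    apply: le_trans (le_trans hb _).
      by rewrite lerDl mulr_ge0 // divr_ge0.
    rewrite ler_wpM2l ?(ltW s0) // ler_piMr // lerBlDr lerDl divr_ge0 //.
  by rewrite ler_piMl.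
have m4 : (4 < m)%N by rewrite -(ltr_nat R); lra.
have rho0 : (0 < rho)%N by rewrite rhoE !muln_gt0 m_gt0 N0.
have rho_ge : (2 * N * m <= rho)%N by rewrite rhoE leq_pmull.
have cone_ge := card_lattice_ball_le_cone x c s x1 c0 cs1 m _ rho
  m4 rho0 rho_ge b_le hb.
have := card_lattice_ball_ratio (R := R) (N := N) p m r p0 m_gt0.
rewrite -rhoE => ratio.
have := leq_trans ratio (leq_mul (leqnn (m ^ N)%N) cone_ge).
set n := #|` _|; set k := #|` _|; rewrite -(ler_nat R) !natrM !natrX => pnk.
have pmn : (p%:R / m%:R) ^+ N * n%:R <= (2 * m).+1%:R * k%:R :> R.
  rewrite expr_div_n mulrAC ler_pdivrMr ?exprn_gt0 //.
  by rewrite [X in _ <= X]mulrC.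
have spm : s ^+ N / 2 <= (p%:R / m%:R) ^+ N.
  (* [s (1 - y) = (m s - 8) / m <= p / m], and [m s >= 16 N] gives [N y <= 1 / 2], so Bernoulli
     loses only a factor 2. *)
  pose y := 8 / (m%:R * s).
  have ms0 : 0 < m%:R * s by rewrite mulr_gt0.
  have y0 : 0 <= y by rewrite divr_ge0 // ltW.
  have Ny : N%:R * y <= 1 / 2.
    by rewrite /y mulrA ler_pdivrMr //; lra.
  have y1 : y <= 1.
    have : y <= N%:R * y by rewrite ler_peMl.
    by lra.
  have /bernoulli_onem_le bern : 0 <= y <= 1 by rewrite y0.
  apply: le_trans (_ : (s * (1 - y)) ^+ N <= _).
    rewrite exprMn ler_wpM2l ?exprn_ge0 ?(ltW s0) //.
    by apply: le_trans (bern N); lra.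
  rewrite ler_pXn2r ?nnegrE ?divr_ge0 // ?mulr_ge0 ?(ltW s0) ?subr_ge0 //.
  rewrite ler_pdivlMr //.
  have -> : s * (1 - y) * m%:R = m%:R * s - 8.
    by rewrite /y; field; rewrite !gt_eqF.
  by lra.
have n0 : 0 <= n%:R :> R by [].
have k0 : 0 <= k%:R :> R by [].
rewrite -[6 * _ * _]mulrA -natrM mE mulrAC ler_pdivrMr ?mulr_gt0 //.
have := le_trans (ler_wpM2r n0 spm) pmn.
rewrite -[(2 * m).+1%:R]natr1 natrM.
have : k%:R <= k%:R * m%:R :> R by rewrite ler_peMr //; lra.
by lra.
Qed.

(** * Averaging over directions *)

(** First-moment argument: integrating the pointwise bound over [D], of mass 1, bounds the sum of
    the measures below by [k * #|A|], so they cannot all be less than [k]. *)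
Lemma exists_measure_ge_average {d} {T : measurableType d} {R : realType}
    (mu : {measure set T -> \bar R}) (D : set T) {I : choiceType}
    (A : {fset I}) (E : I -> set T) (k : R) :
  measurable D -> mu D = 1%E -> (forall i, measurable (E i)) ->
  (0 < #|` A|)%N -> 0 <= k ->
  (forall u, D u -> k * #|` A|%:R <= \sum_(i <- A) \1_(E i) u) ->
  exists2 i, i \in A & (k%:E <= mu (E i `&` D))%E.
Proof.
move=> mD muD mE A0 k0 kA; apply: contrapT => noi.
have lt_k i : i \in A -> (mu (E i `&` D) < k%:E)%E.
  by move=> iA; rewrite ltNge; apply/negP => ki; apply: noi; exists i.
have : ((k * #|` A|%:R)%:E <= \sum_(i <- A) mu (E i `&` D))%E.
  have -> : ((k * #|` A|%:R)%:E = \int[mu]_(u in D) (cst (k * #|` A|%:R)%:E) u)%E.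
    by rewrite integral_cst // [mu D]muD mule1.
  have mf i : measurable_fun D (fun u => (\1_(E i) u : R)%:E).
    by apply/measurable_EFinP; exact: measurable_indic.
  under eq_bigr do rewrite -integral_indic //.
  rewrite -ge0_integral_sum //.
  apply: ge0_le_integral => //.
  - by move=> u _; rewrite lee_fin mulr_ge0.
  - exact: emeasurable_sum.
  by move=> u Du; rewrite sumEFin lee_fin kA.
apply/negP; rewrite -ltNge.
have -> : (\sum_(i <- A) mu (E i `&` D) = (\sum_(i <- A) fine (mu (E i `&` D)))%:E)%E.
  rewrite -sumEFin; apply: eq_big_seq => i iA; rewrite fineK // ge0_fin_numE //.
  exact: lt_trans (lt_k i iA) (ltry k).
have -> : k * #|` A|%:R = \sum_(i <- A) k.
  by rewrite big_const_seq count_predT iter_addr_0 mulr_natr.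
rewrite lte_fin big_seq [ltRHS]big_seq; apply: ltr_sum.
  by move: A0; rewrite cardfs_gt0 => /fset0Pn[i iA]; apply/hasP; exists i.
move=> i iA; rewrite -lte_fin fineK ?lt_k // ge0_fin_numE //.
exact: lt_trans (lt_k i iA) (ltry k).
Qed.

Lemma exists_direction_measure_ge {R : realType} {N : nat} (S c sn : R) (m0 : nat)
    (s : R -> 'I_N -> R) :
  0 < c -> 0 < sn -> c ^+ 2 + sn ^+ 2 = 1 -> (0 < N)%N -> 16 <= m0%:R * sn ->
  0 < S ->
  (forall i : 'I_N, measurable_fun `[(0:R)%R, 1%R[ (fun u => s u i)) ->
  (forall u, u \in `[(0:R)%R, 1%R[ -> normv (s u) = S) ->
  exists g : 'I_N -> R, normv g = 1 /\
    ((sn ^+ N / (6 * m0 * N)%:R)%:E <=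
     (@lebesgue_measure R) ([set u | u \in `[(0:R)%R, 1%R[ ] `&`
                             [set u | (S * c <= dotv (s u) g)%R]))%E.
Proof.
move=> c0 sn0 cs1 N0 m0s S0 ms normS.
pose D : set R := [set` `[(0:R)%R, 1%R[].
have mD : measurable D by exact: measurable_itv.
pose rho := (2 * N * (m0 * N) ^ 2)%N.
pose A := lattice_ball (R := R) (N := N) rho.
pose y (g : {ffun 'I_N -> int}) u : R := dotv (s u) (vec_of_lattice g).
have my g : measurable_fun D (y g).
  by apply: measurable_sum => i; apply: measurable_funM => //; exact: ms.
(* For [u] in [D], [E g] says that [g] lies in the cone around [s u / S]; as an intersection of
   preimages under [y g] it is measurable. *)
pose E (g : {ffun 'I_N -> int}) : set R :=
  (D `&` y g @^-1` `]0, +oo[) `&`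
  (D `&` y g @^-1` `[S * c * normv (vec_of_lattice (R := R) g), +oo[).
have mE g : measurable (E g).
  by apply: measurableI; apply: my => //; exact: measurable_itv.
have m00 : (0 < m0)%N.
  by rewrite lt0n; apply: contraTneq m0s => ->; rewrite mul0r -ltNge.
have k0 : 0 < sn ^+ N / (6 * m0 * N)%:R :> R.
  by rewrite divr_gt0 ?exprn_gt0 // ltr0n !muln_gt0 m00 N0.
have A0 : (0 < #|` A|)%N.
  rewrite cardfs_gt0; apply/fset0Pn; exists [ffun=> 0]; rewrite in_lattice_ball.
  rewrite normv_le // /dotv big1 ?sqr_ge0 // => i _.
  by rewrite /vec_of_lattice ffunE mul0r.
have muD : lebesgue_measure D = 1%E :> \bar R.
  by rewrite lebesgue_measure_itv /= lte_fin ltr01 oppr0 adde0.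
have [|g gA gE] := @exists_measure_ge_average _ _ _ lebesgue_measure D _ A E
  _ mD muD mE A0 (ltW k0).
  move=> u Du; have uI : u \in `[(0:R)%R, 1%R[ by [].
  pose x i := S^-1 * s u i.
  have Sn0 : S != 0 by rewrite gt_eqF.
  have x1 : normv x = 1.
    by rewrite normvZ normS // gtr0_norm ?invr_gt0 // mulVf.
  have xy g : dotv x (vec_of_lattice g) = S^-1 * y g u by rewrite dotvZl.
  apply: le_trans (card_lattice_cone_ge x c sn m0 x1 c0 sn0 cs1 N0 m0s) _.
  rewrite -/rho.
  have -> : \sum_(i <- A) \1_(E i) u = \sum_(i <- A | i \in lattice_cone x c rho) 1 :> R.
    rewrite [RHS]big_mkcond /=; apply: eq_big_seq => g gA.
    rewrite indicE in_lattice_cone gA xy pmulr_rgt0 ?invr_gt0 //=.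
    rewrite ler_pdivlMl // mulrA.
    have -> : (u \in E g) = (0 < y g u) && (S * c * normv (vec_of_lattice (R := R) g) <= y g u).
      apply/idP/idP => [/set_mem|/andP[y0 yc]].
        by rewrite /E /= !in_itv /= !andbT => -[[_ ->] [_ ->]].
      by apply/mem_set; rewrite /E /= !in_itv /= !andbT.
    by case: ifP.
  rewrite -big_filter big_const_seq count_predT iter_addr_0 ler_nat.
  rewrite uniq_leq_size // => g gc; rewrite mem_filter gc.
  by move: gc; rewrite in_lattice_cone => /andP[].
pose v := vec_of_lattice (R := R) g.
(* The origin is never selected: its [E g] is empty, while the selected measure is at least a
   positive number. *)
have v0 : 0 < normv v.
  rewrite lt_neqAle normv_ge0 andbT eq_sym; apply/negP => /eqP v0.
  suff E0 : E g = set0.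
    by move: gE; rewrite E0 set0I measure0 lee_fin leNgt k0.
  apply/seteqP; split => // u [[_ /=]]; rewrite in_itv /= andbT => y0 _.
  have := dotv_le_normv (s u) v; rewrite v0 mulr0 normr_le0 => /eqP yE.
  by move: y0; rewrite /y yE ltxx.
exists (fun i => (normv v)^-1 * v i); split.
  by rewrite normvZ gtr0_norm ?invr_gt0 // mulVf // gt_eqF.
apply: le_trans gE _; apply: le_measure.
- by apply/mem_set; apply: measurableI => //; exact: mE.
- apply/mem_set; have -> : [set u | S * c <= dotv (s u) (fun i => (normv v)^-1 * v i)] =
     y g @^-1` `[S * c * normv v, +oo[.
    apply/seteqP; split=> u /=; rewrite in_itv /= andbT dotvZr;
      by rewrite ler_pdivlMl // mulrC.
  by apply: my => //; exact: measurable_itv.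
- move=> u [[_ [Du]]] /=; rewrite in_itv /= andbT => yu _; split => //=.
  by rewrite dotvZr ler_pdivlMl // mulrC.
Qed.

(** * Rewriting the bound in exponential form *)

Theorem mainTheorem4 (R : realType) (theta : R) :
  0 < theta < pi / 2 ->
  exists r : nat -> R,
    (* r(N) = Theta(log N / N) as N -> oo, depending only on N and theta *)
    (exists (c C : R) (N0 : nat), 0 < c /\ 0 < C /\
       forall N : nat, (N0 <= N)%N ->
         c * (ln N%:R / N%:R) <= r N /\ r N <= C * (ln N%:R / N%:R)) /\
    forall (N : nat) (S : R) (s : R -> 'I_N -> R),
      (0 < N)%N -> 0 < S ->
      (forall i : 'I_N, measurable_fun `[(0:R)%R, 1%R[ (fun u => s u i)) ->
      (forall u, u \in `[(0:R)%R, 1%R[ -> normv (s u) = S) ->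
      exists g : 'I_N -> R, normv g = 1 /\
        ((expR (N%:R / 2 * (ln (sin theta ^+ 2) - r N)))%:E <=
         (@lebesgue_measure R) ([set u | u \in `[(0:R)%R, 1%R[ ] `&`
                                 [set u | (S * cos theta <= dotv (s u) g)%R]))%E.
Proof.
move=> /andP[theta0 thetapi].
have s0 : 0 < sin theta by apply: sin_gt0_pi; rewrite theta0 /=; lra.
have c0 : 0 < cos theta by apply: cos_gt0_pihalf; rewrite thetapi andbT; lra.
pose m0 := (Num.truncn (16 / sin theta)).+1.
have m0s : 16 <= m0%:R * sin theta.
  rewrite -ler_pdivrMr // ltW //.
  have h : 0 <= 16 / sin theta by rewrite divr_ge0 // ltW.
  by have /andP[] := truncn_itv h.
(* Chosen so that the exponential equals [sin theta ^ N / (6 * m0 * N)]; [m0] depends on [theta]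
   alone. *)
exists (fun N => 2 * (ln (6 * m0 * N)%:R / N%:R)); split.
  (* For [N >= 6 * m0], [N <= 6 * m0 * N <= N ^ 2], so the logarithm lies between [ln N] and
     [2 ln N]. *)
  exists 2, 4, (6 * m0)%N; split => //; split => // N N0.
  have N_gt0 : (0 < N)%N by apply: leq_trans N0.
  have Nr : 0 < N%:R :> R by rewrite ltr0n.
  have L0 : 0 < (6 * m0 * N)%:R :> R by rewrite ltr0n muln_gt0 N_gt0.
  split.
    rewrite ler_pM2l // ler_pM2r ?invr_gt0 // ler_ln ?posrE // ler_nat.
    by rewrite leq_pmull.
  rewrite (_ : 4 = 2 * 2 :> R); last by ring.
  rewrite -mulrA ler_pM2l // mulrA ler_pM2r ?invr_gt0 //.
  rewrite mulr_natl -lnXn // ler_ln ?posrE ?exprn_gt0 //.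
  by rewrite -natrX ler_nat expnS expn1 leq_mul2r N0 orbT.
move=> N S s N0 S0 ms normS.
have L0 : 0 < (6 * m0 * N)%:R :> R by rewrite ltr0n muln_gt0 N0.
have -> : expR (N%:R / 2 * (ln (sin theta ^+ 2) - 2 * (ln (6 * m0 * N)%:R / N%:R)))
    = sin theta ^+ N / (6 * m0 * N)%:R.
  rewrite -[RHS]lnK ?posrE ?divr_gt0 ?exprn_gt0 //; congr expR.
  rewrite ln_div ?posrE ?exprn_gt0 // !lnXn //.
  rewrite -[_ *+ N in RHS]mulr_natr -[_ *+ 2]mulr_natr.
  by field; rewrite gt_eqF // ltr0n.
exact: exists_direction_measure_ge (cos2Dsin2 theta) N0 m0s S0 ms normS.
Qed.
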